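(* Let $p\le0.5$ and $\gamma\in[0,1]$. Then there exists a $\gamma$-oblivious adversary such that no algorithm can distinguish between $G(n,p)$ and $G\!\left(n,\,p+0.1\max\left(\gamma\sqrt{p/n},\ \gamma/n,\ \sqrt p/n\right)\right)$ (after corruption by this adversary) with probability at least $0.65$.
   Context: $G(n,q)$ is the distribution over undirected graphs on $[n]$ with each edge present independently with probability $q$. A $\gamma$-oblivious adversary knows the edge parameter but not the realized graph; it chooses (possibly randomly) a set $B\subseteq[n]$ with $|B|\le\gamma n$ and a distribution for the status of all edges with at least one endpoint in $B$, and replaces those edges accordingly, independently of the realization. An algorithm distinguishes the two models with probability at least $0.65$ if, given the corrupted graph, it outputs which model generated it and is correct with probability at least $0.65$. *)

(* Defs.v *)
From HB Require Import structures.
From mathcomp Require Import all_boot all_order all_algebra.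
From mathcomp Require Import reals.

Set Implicit Arguments.
Unset Strict Implicit.
Unset Printing Implicit Defensive.

Import Order.TTheory GRing.Theory Num.Theory.
Local Open Scope ring_scope.

Record fdist (R : realType) (T : finType) := FDist {
  fdist_fun :> T -> R;
  fdist_ge0 : forall x, 0 <= fdist_fun x;
  fdist_sum1 : \sum_(x : T) fdist_fun x = 1
}.

(* Simple undirected graphs on [n]: an edge is a two-element set of vertices
   and a graph is a set of edges. *)
Definition edge (n : nat) := {e : {set 'I_n} | #|e| == 2%N}.
Definition graph (n : nat) := {set edge n}.

Definition touches (n : nat) (B : {set 'I_n}) (e : edge n) : bool :=
  [exists v in B, v \in val e].

(* The probability mass function of G(n, q). It is defined for every real q,
   and is a distribution when 0 <= q <= 1 (see gnp_ge0 and gnp_sum1). *)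
Definition gnp (R : realType) (n : nat) (q : R) (G : graph n) : R :=
  \prod_(e : edge n) (if e \in G then q else 1 - q).

(* The graph that agrees with H on the edges having an endpoint in B, and with
   G on all other edges. *)
Definition corrupt (n : nat) (B : {set 'I_n}) (H G : graph n) : graph n :=
  [set e | if touches B e then e \in H else e \in G].

(* The adversary knows the edge parameter, which is the first argument of both
   fields, but not the realized graph: it draws B from adv_set, then the status
   of the edges touching B from adv_edges, possibly with arbitrary correlations
   between them. The status that adv_edges gives to the remaining edges is
   ignored by corrupt. *)
Record oblivious_adversary (R : realType) (n : nat) (gamma : R) := Adversary {
  adv_set : R -> fdist R {set 'I_n};
  adv_edges : R -> {set 'I_n} -> fdist R (graph n);
  adv_budget : forall (q : R) (B : {set 'I_n}),
    adv_set q B != 0 -> #|B|%:R <= gamma * n%:R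
}.

(* The law of the corrupted graph when the uncorrupted one is drawn from
   G(n, q), independently of the choices of the adversary. *)
Definition corrupted_gnp (R : realType) (n : nat) (gamma : R)
    (A : oblivious_adversary n gamma) (q : R) (K : graph n) : R :=
  \sum_(G : graph n) \sum_(B : {set 'I_n})
    \sum_(H : graph n | corrupt B H G == K)
      gnp q G * adv_set A q B * adv_edges A q B H.

(* A randomized algorithm; false stands for the first model, true for the
   second. *)
Definition algorithm (R : realType) (n : nat) := graph n -> fdist R bool.

Definition output_prob (R : realType) (n : nat) (gamma : R)
    (A : oblivious_adversary n gamma) (alg : algorithm R n) (q : R) (b : bool)
    : R :=
  \sum_(K : graph n) corrupted_gnp A q K * alg K b.

(* The probability of a correct answer when the model is one of G(n, q0) and
   G(n, q1), each with probability 1/2. *)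
Definition correct_prob (R : realType) (n : nat) (gamma : R)
    (A : oblivious_adversary n gamma) (alg : algorithm R n) (q0 q1 : R) : R :=
  (output_prob A alg q0 false + output_prob A alg q1 true) / 2.

Definition distinguishes (R : realType) (n : nat) (gamma : R)
    (A : oblivious_adversary n gamma) (alg : algorithm R n) (q0 q1 c : R)
    : Prop :=
  c <= correct_prob A alg q0 q1.

(* An algorithm that is correct with probability at least c under each of the
   two models distinguishes them, so ruling out distinguishes also rules out
   correctness in the worst case over the models. *)
Lemma worst_case_distinguishes (R : realType) (n : nat) (gamma : R)
    (A : oblivious_adversary n gamma) (alg : algorithm R n) (q0 q1 c : R) :
  c <= output_prob A alg q0 false -> c <= output_prob A alg q1 true ->
  distinguishes A alg q0 q1 c.
Proof.
move=> h0 h1; rewrite /distinguishes /correct_prob ler_pdivlMr ?ltr0n //.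
by rewrite mulr_natr mulr2n lerD.
Qed.

Lemma gnp_ge0 (R : realType) (n : nat) (q : R) (G : graph n) :
  0 <= q <= 1 -> 0 <= gnp q G.
Proof.
move=> /andP[q0 q1]; apply: prodr_ge0 => e _.
by case: ifP; rewrite ?subr_ge0.
Qed.

Lemma gnp_sum1 (R : realType) (n : nat) (q : R) :
  \sum_(G : graph n) gnp q G = 1.
Proof.
rewrite /gnp.
have: \prod_(e : edge n) (q + (1 - q)) = 1.
  by rewrite big1 // => e _; rewrite addrCA subrr addr0.
rewrite bigA_distr => h; rewrite -[RHS]h.
by apply: eq_big => // G; rewrite inE.
Qed.

Lemma corrupted_gnp_ge0 (R : realType) (n : nat) (gamma : R)
    (A : oblivious_adversary n gamma) (q : R) (K : graph n) :
  0 <= q <= 1 -> 0 <= corrupted_gnp A q K.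
Proof.
move=> q01; apply: sumr_ge0 => G _; apply: sumr_ge0 => B _.
by apply: sumr_ge0 => H _; rewrite !mulr_ge0 ?gnp_ge0 ?fdist_ge0.
Qed.

Lemma corrupted_gnp_sum1 (R : realType) (n : nat) (gamma : R)
    (A : oblivious_adversary n gamma) (q : R) :
  \sum_(K : graph n) corrupted_gnp A q K = 1.
Proof.
rewrite exchange_big -[RHS](gnp_sum1 n q); apply: eq_bigr => G _ /=.
rewrite exchange_big -[RHS]mulr1 -(fdist_sum1 (adv_set A q)) mulr_sumr.
apply: eq_bigr => B _ /=.
rewrite -[RHS]mulr1 -(fdist_sum1 (adv_edges A q B)) mulr_sumr.
by rewrite [RHS](partition_big (fun H => corrupt B H G) predT).
Qed.

(* Main.v *)
Require Import Defs.
From mathcomp Require Import all_boot all_order all_algebra.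
From mathcomp Require Import reals ring lra.

Set Implicit Arguments.
Unset Strict Implicit.
Unset Printing Implicit Defensive.

Import Order.TTheory GRing.Theory Num.Theory.
Local Open Scope ring_scope.

(** Assign every edge to one of its endpoints. Under G(n, q) the rows of edges
    assigned to the vertices are independent product laws on at most n
    coordinates. If the rows P_v, Q_v of the two models are within total
    variation t = gamma / 10, then (1 - tau) P_v + tau W_v = (1 - tau) Q_v +
    tau W'_v for tau = t / (1 + t) and suitable laws W_v, W'_v. An adversary
    that corrupts each vertex independently with probability tau, redraws the
    row of a corrupted vertex from W_v (resp. W'_v) and every other edge it
    controls from the original model, gives both models exactly the same law,
    except when the corrupted set exceeds the budget, which by Markov has
    probability at most tau / gamma <= 1 / 10. The row distance is bounded by a
    union bound for the shift gamma / n and by the chi-square divergence for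
    the shift gamma * sqrt (p / n). For the shift sqrt p / n the chi-square
    divergence of the whole graph is small, and no corruption is needed. *)

(** * Product Bernoulli laws on subsets and their distances *)

Section BernoulliSubset.
Variables (R : realType) (T : finType).
Implicit Types (D S : {set T}) (p q d s : R).

(** The law of a random subset of [D]. It ignores [S] outside [D], so that whole graphs can be
    plugged into row laws. *)
Definition bern D q S : R := \prod_(e in D) (if e \in S then q else 1 - q).

Lemma sum_subset_prod D (a b : R) :
  \sum_(S : {set T} | S \subset D) \prod_(e in D) (if e \in S then a else b)
  = (a + b) ^+ #|D|.
Proof.
rewrite -prodr_const.
(* Coordinates outside [D] get the factor 0 + 1, so the expansion over all sets keeps only the
   subsets of [D]. *)
have -> : \prod_(e in D) (a + b) =
  \prod_(e : T) ((if e \in D then a else 0) + (if e \in D then b else 1)).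
  rewrite big_mkcond; apply: eq_bigr => e _.
  by case: ifP => // _; rewrite add0r.
rewrite bigA_distr big_mkcond /=; apply: eq_big => // S _.
case: ifPn => [sSD|/subsetPn[e eS eD]].
  rewrite big_mkcond; apply: eq_bigr => e _.
  case: ifPn => [eD|eD]; case: ifPn => //.
  by move/(subsetP sSD); rewrite (negPf eD).
by rewrite (bigD1 e) //= eS (negPf eD) mul0r.
Qed.

Lemma bern_sum1 D q : \sum_(S : {set T} | S \subset D) bern D q S = 1.
Proof. by rewrite sum_subset_prod addrC subrK expr1n. Qed.

Lemma bern_ge0 D q S : 0 <= q <= 1 -> 0 <= bern D q S.
Proof.
by move=> /andP[q0 q1]; apply: prodr_ge0 => e _; case: ifP; rewrite ?subr_ge0.
Qed.

Lemma bern_gt0 D q S : 0 < q < 1 -> 0 < bern D q S.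
Proof.
by move=> /andP[q0 q1]; apply: prodr_gt0 => e _; case: ifP; rewrite ?subr_gt0.
Qed.

Lemma bern_eq_in D q S S' : {in D, forall e, (e \in S) = (e \in S')} ->
  bern D q S = bern D q S'.
Proof. by move=> SS'; apply: eq_bigr => e /SS' ->. Qed.

Lemma bern_mean q :
  \sum_(S : {set T}) bern setT q S * #|S|%:R = #|T|%:R * q.
Proof.
have E S :
    bern setT q S * #|S|%:R = \sum_(x : T) bern setT q S * (x \in S)%:R.
  by rewrite -mulr_sumr -natr_sum -sum1_card [in LHS]big_mkcond.
under eq_bigr do rewrite E.
rewrite exchange_big /= mulr_natl -sumr_const; apply: eq_bigr => x _.
(* Omitting [1 - q] at [x] restricts the expansion of the product to the sets containing [x]. *)
have {2}-> : q = \prod_(e : T) (q + (if e == x then 0 else 1 - q)).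
  rewrite (bigD1 x) //= eqxx addr0 big1 ?mulr1 // => e /negPf ->.
  by rewrite addrC subrK.
rewrite bigA_distr; apply: eq_big => // S _.
rewrite /bern; under eq_bigl do rewrite inE.
rewrite (bigD1 x) // [RHS](bigD1 x) //= eqxx.
case: ifP => _; last by rewrite mulr0 mul0r.
rewrite mulr1; congr (_ * _); apply: eq_bigr => e /negPf ->.
by [].
Qed.

(** The L1 distance, twice the total variation. *)
Definition dist1 D p q : R :=
  \sum_(S : {set T} | S \subset D) `|bern D p S - bern D q S|.

Lemma dist1C D p q : dist1 D p q = dist1 D q p.
Proof. by apply: eq_bigr => S _; rewrite distrC. Qed.

Lemma bernoulli_ineq (x : R) (k : nat) :
  0 <= x <= 1 -> 1 - k%:R * x <= (1 - x) ^+ k.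
Proof.
move=> /andP[x0 x1]; elim: k => [|k IH]; first by rewrite mul0r subr0.
rewrite exprS; have k0 : 0 <= k%:R :> R by [].
have: (1 - x) * (1 - k%:R * x) <= (1 - x) * (1 - x) ^+ k.
  by apply: ler_wpM2l => //; rewrite subr_ge0.
apply: le_trans; rewrite -natr1.
have : 0 <= k%:R * x * x by rewrite !mulr_ge0.
lra.
Qed.

(* The product of the coordinatewise minima lies below both laws and has total
   mass (1 - d) ^+ #|D|. *)
Lemma dist1_le_linear D p d :
  0 <= p -> 0 <= d -> p + d <= 1 -> dist1 D p (p + d) <= 2 * (#|D|%:R * d).
Proof.
move=> p0 d0 pd1.
pose m S := \prod_(e in D) (if e \in S then p else 1 - (p + d)).
have mP S : m S <= bern D p S.
  apply: ler_prod => e _; case: ifP => _; first by rewrite p0 lexx.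
  by apply/andP; split; lra.
have mQ S : m S <= bern D (p + d) S.
  apply: ler_prod => e _; case: ifP => _; first by apply/andP; split; lra.
  by apply/andP; split; lra.
have ms : \sum_(S : {set T} | S \subset D) m S = (1 - d) ^+ #|D|.
  by rewrite sum_subset_prod; congr (_ ^+ _); ring.
have -> : 2 * (#|D|%:R * d) = 2 - 2 * (1 - #|D|%:R * d) by ring.
apply: (@le_trans _ _ (2 - 2 * (1 - d) ^+ #|D|)); last first.
  have : 1 - #|D|%:R * d <= (1 - d) ^+ #|D|.
    by apply: bernoulli_ineq; apply/andP; split; lra.
  lra.
have -> : 2 - 2 * (1 - d) ^+ #|D| = \sum_(S : {set T} | S \subset D)
    (bern D p S + bern D (p + d) S - 2 * m S).
  by rewrite sumrB -mulr_sumr ms big_split /= !bern_sum1.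
apply: ler_sum => S _; have := mP S; have := mQ S.
by case: (ler0P (bern D p S - bern D (p + d) S)); lra.
Qed.

(** Expand the square: Q^2 / P factors over the coordinates, while P and Q sum to 1. *)
Lemma chi_square_bern D p d : 0 < p < 1 ->
  \sum_(S : {set T} | S \subset D)
    (bern D p S - bern D (p + d) S) ^+ 2 / bern D p S
  = (1 + d ^+ 2 / (p * (1 - p))) ^+ #|D| - 1.
Proof.
move=> /andP[p0 p1].
have pn0 : p != 0 by rewrite gt_eqF.
have qn0 : 1 - p != 0 by rewrite gt_eqF // subr_gt0.
have -> : 1 + d ^+ 2 / (p * (1 - p)) =
    (p + d) ^+ 2 / p + (1 - (p + d)) ^+ 2 / (1 - p).
  by field; rewrite pn0 qn0.
rewrite -sum_subset_prod.
have -> : \sum_(S : {set T} | S \subset D)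
    (bern D p S - bern D (p + d) S) ^+ 2 / bern D p S =
  \sum_(S : {set T} | S \subset D)
    (bern D (p + d) S ^+ 2 / bern D p S - 2 * bern D (p + d) S + bern D p S).
  apply: eq_bigr => S _.
  have : bern D p S != 0 by rewrite gt_eqF // bern_gt0 ?p0.
  by move=> ?; field.
rewrite big_split sumrB /= -mulr_sumr !bern_sum1.
have -> : \sum_(S : {set T} | S \subset D) bern D (p + d) S ^+ 2 / bern D p S
  = \sum_(S : {set T} | S \subset D) \prod_(e in D)
     (if e \in S then (p + d) ^+ 2 / p else (1 - (p + d)) ^+ 2 / (1 - p)).
  apply: eq_bigr => S _.
  rewrite /bern -prodrXl -prodf_div; apply: eq_bigr => e _.
  by case: ifP.
by ring.
Qed.

(** Since (1 + x)^k (1 - x)^k <= 1, Bernoulli's inequality for (1 - x)^k suffices. *)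
Lemma expr1D_le (x y : R) (k : nat) :
  0 <= x -> x <= 1 -> k%:R * x <= y -> y < 1 -> (1 + x) ^+ k <= (1 - y)^-1.
Proof.
move=> x0 x1 kx y1.
have y0 : 0 < 1 - y by lra.
rewrite -[leRHS]mul1r ler_pdivlMr //.
have b : 1 - y <= (1 - x) ^+ k.
  by apply: le_trans (bernoulli_ineq k _); rewrite ?x0 //; lra.
apply: (@le_trans _ _ ((1 + x) ^+ k * (1 - x) ^+ k)).
  by rewrite ler_wpM2l // exprn_ge0 //; lra.
rewrite -exprMn; apply: exprn_ile1; nra.
Qed.

(** As 1 - p >= 1 / 2, each coordinate contributes at most 2 d^2 / p, so the divergence is at most 1
    / (1 - s^2 / 50) - 1 <= (3 s / 20)^2. *)
Lemma dist1_le_chi_square D p d s :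
  0 < p <= 1 / 2 -> 0 < s <= 1 ->
  #|D|%:R * (2 * d ^+ 2 / p) <= 1 / 50 * s ^+ 2 ->
  dist1 D p (p + d) <= 3 / 20 * s.
Proof.
move=> /andP[p0 p2] /andP[s0 s1] hD.
(* The bound [x <= 1] below is read off the one on [#|D|%:R * x], which needs [D] nonempty. *)
have [->|D0] := eqVneq D set0.
  rewrite /dist1 (eq_bigr (fun=> 0)) ?big1_eq; first by lra.
  by move=> S _; rewrite /bern !big_set0 subrr normr0.
have s2 : s ^+ 2 <= 1 by nra.
have p01 : 0 < p < 1 by apply/andP; split; lra.
pose x := d ^+ 2 / (p * (1 - p)).
have xe : x <= 2 * d ^+ 2 / p.
  rewrite /x -mulrA mulrCA ler_wpM2l ?sqr_ge0 //.
  rewrite invfM mulrC ler_pM2r ?invr_gt0 //.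
  rewrite -[leLHS]mul1r ler_pdivrMr; lra.
have x0 : 0 <= x by rewrite divr_ge0 ?sqr_ge0 // mulr_ge0; lra.
have kx : #|D|%:R * x <= 1 / 50 * s ^+ 2.
  by apply: le_trans hD; rewrite ler_wpM2l.
have x1 : x <= 1.
  have k1 : 1 <= #|D|%:R :> R by rewrite ler1n card_gt0.
  have : 1 * x <= #|D|%:R * x by rewrite ler_wpM2r.
  lra.
have chi : (1 + x) ^+ #|D| - 1 <= 9 / 400 * s ^+ 2.
  have y1 : 1 / 50 * s ^+ 2 < 1 by lra.
  have := expr1D_le x0 x1 kx y1.
  suff : (1 - 1 / 50 * s ^+ 2)^-1 <= 1 + 9 / 400 * s ^+ 2 by lra.
  rewrite -[leLHS]mul1r ler_pdivrMr; last by lra.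
  have := sqr_ge0 s; nra.
pose r : R := 3 / 20 * s; have r0 : 0 < r by rewrite /r; lra.
have -> : 3 / 20 * s = r by [].
(* AM-GM: [`|P - Q| <= (r P + (P - Q)^2 / (r P)) / 2] *)
apply: (@le_trans _ _ (\sum_(S : {set T} | S \subset D)
   (r / 2 * bern D p S + (2 * r)^-1 *
     ((bern D p S - bern D (p + d) S) ^+ 2 / bern D p S)))).
  apply: ler_sum => S _; have P0 := bern_gt0 D S p01.
  set a := bern D p S in P0 *.
  rewrite -[X in _ <= _ + _ * (X / _)]real_normK ?num_real //.
  set z := `|_|.
  rewrite -subr_ge0.
  have -> : r / 2 * a + (2 * r)^-1 * (z ^+ 2 / a) - z =
     (r * a - z) ^+ 2 / (2 * r * a).
    by field; rewrite !gt_eqF.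
  apply: divr_ge0; first exact: sqr_ge0.
  by apply: ltW; do 2! apply: mulr_gt0 => //.
rewrite big_split /= -!mulr_sumr bern_sum1 chi_square_bern //.
apply: (@le_trans _ _ (r / 2 * 1 + (2 * r)^-1 * r ^+ 2)).
  rewrite lerD2l ler_wpM2l //; first by rewrite invr_ge0; lra.
  by apply: le_trans chi _; rewrite /r; nra.
have -> : r / 2 * 1 + (2 * r)^-1 * r ^+ 2 = r by field; rewrite gt_eqF.
by [].
Qed.

End BernoulliSubset.

(** * Rows of edges owned by the vertices *)

Section Rows.
Variables (R : realType) (n : nat).
Implicit Types (B : {set 'I_n}) (G H K : graph n) (v : 'I_n).

Lemma edge_nonempty (e : edge n) : exists v, v \in val e.
Proof. by apply/set0Pn; rewrite -card_gt0 (eqP (valP e)). Qed.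

(** Any choice of endpoint would do: the stars partition the edges, and a corrupted vertex controls
    its whole star. *)
Definition owner (e : edge n) : 'I_n := xchoose (edge_nonempty e).

Lemma owner_in (e : edge n) : owner e \in val e.
Proof. exact: xchooseP. Qed.

Definition star v : {set edge n} := [set e | owner e == v].

Lemma star_touches B v e : v \in B -> e \in star v -> touches B e.
Proof.
move=> vB; rewrite inE => /eqP ev; apply/existsP; exists v.
by rewrite vB -ev owner_in.
Qed.

Lemma card_star v : (#|star v| <= n)%N.
Proof.
rewrite -(card_imset _ val_inj) /=.
apply: (@leq_trans #|[set [set v; u] | u in 'I_n]|); last first.
  by apply: leq_trans (leq_imset_card _ _) _; rewrite card_ord.
apply/subset_leq_card/subsetP => s /imsetP[e]; rewrite inE => /eqP ev ->.
have /cards2P[x [y [xy Ee]]] := valP e.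
have := owner_in e; rewrite ev Ee => /set2P[->|->].
  by apply/imsetP; exists y.
by apply/imsetP; exists x => //; rewrite setUC.
Qed.

Lemma card_edge : (#|[set: edge n]| <= n * n)%N.
Proof.
rewrite -sum1_card (partition_big owner predT) //=.
apply: (@leq_trans (\sum_(v < n) n)); last by rewrite sum_nat_const card_ord.
apply: leq_sum => v _; apply: leq_trans (card_star v).
by rewrite -sum1_card; apply/eq_leq/eq_bigl => e; rewrite !inE.
Qed.

Lemma gnp_bernT (q : R) G : gnp q G = bern setT q G.
Proof. by apply: eq_bigl => e; rewrite inE. Qed.

Lemma gnp_star (q : R) G : gnp q G = \prod_v bern (star v) q G.
Proof.
rewrite /gnp (partition_big owner predT) //=.
by apply: eq_bigr => v _; apply: eq_bigl => e; rewrite inE.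
Qed.

(** A graph is the same as a family of rows [G :&: star v], so the sum distributes over the
    product. *)
Lemma sum_prod_star (f : 'I_n -> graph n -> R) :
    (forall v G, f v (G :&: star v) = f v G) ->
  \sum_(G : graph n) \prod_v f v G =
  \prod_v \sum_(S : graph n | S \subset star v) f v S.
Proof.
move=> hf; rewrite bigA_distr_big_dep /=.
rewrite (reindex_onto (fun G : graph n => [ffun v => G :&: star v])
  (fun F : {ffun 'I_n -> graph n} => \bigcup_v F v)) /=; last first.
  move=> F /familyP hF; apply/ffunP => v; rewrite ffunE.
  apply/setP => e; rewrite inE; apply/andP/idP => [[/bigcupP[u _ eu]]|ev].
    have := subsetP (hF u) _ eu.
    by rewrite !inE => /eqP-> /eqP<-.
  by split; [apply/bigcupP; exists v | exact: (subsetP (hF v))].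
apply: eq_big => [G|G _]; last by apply: eq_bigr => v _; rewrite ffunE hf.
symmetry; apply/andP; split.
  by apply/familyP => v; rewrite ffunE; exact: subsetIr.
apply/eqP/setP => e; apply/bigcupP/idP => [[v _]|eG].
  by rewrite ffunE inE => /andP[].
by exists (owner e) => //; rewrite ffunE !inE eG eqxx.
Qed.

(* The law drawn by a corrupted vertex: the positive part of Q - P, topped up
   to mass t symmetrically in P and Q, and normalised. *)
Definition excess (p q t : R) v G : R :=
  ((`|bern (star v) p G - bern (star v) q G|
     + (bern (star v) q G - bern (star v) p G)) / 2
   + (t - dist1 (star v) p q / 2)
     * ((bern (star v) p G + bern (star v) q G) / 2)) / t.

(** Rows of uncorrupted vertices are redrawn too, since some of their edges may touch [B]. *)
Definition planted (p q t : R) B G : R :=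
  \prod_v (if v \in B then excess p q t v G else bern (star v) p G).

(** As (|P - Q| + P + Q) / 2 = max(P, Q), this is the pointwise maximum, topped up to mass 1 + t and
    normalised. *)
Definition mixed (p q t : R) v G : R :=
  ((`|bern (star v) p G - bern (star v) q G|
     + (bern (star v) p G + bern (star v) q G)) / 2
   + (t - dist1 (star v) p q / 2)
     * ((bern (star v) p G + bern (star v) q G) / 2)) / (1 + t).

Lemma mixedC p q t v G : mixed p q t v G = mixed q p t v G.
Proof.
by rewrite /mixed distrC dist1C (addrC (bern _ p G)).
Qed.

Lemma mixedE p q t v G : 0 < t ->
  t / (1 + t) * excess p q t v G
  + (1 - t / (1 + t)) * bern (star v) p G = mixed p q t v G.
Proof.
move=> t0; rewrite /mixed /excess; field.
by rewrite !gt_eqF //; lra.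
Qed.

Lemma excess_eq_in p q t v G H :
    {in star v, forall e, (e \in G) = (e \in H)} ->
  excess p q t v G = excess p q t v H.
Proof. by move=> GH; rewrite /excess !(bern_eq_in _ GH). Qed.

Section PlantedLaw.
Variables (p q t : R).
Hypotheses (p01 : 0 <= p <= 1) (q01 : 0 <= q <= 1) (t0 : 0 < t).
Hypothesis dist_le : forall v, dist1 (star v) p q <= 2 * t.

Lemma excess_ge0 v G : 0 <= excess p q t v G.
Proof.
apply: divr_ge0; last exact: ltW.
have P0 := bern_ge0 (star v) G p01; have Q0 := bern_ge0 (star v) G q01.
apply: addr_ge0.
  by have := ler_norm (bern (star v) p G - bern (star v) q G); lra.
(* The distance hypothesis makes the top-up coefficient nonnegative. *)
by apply: mulr_ge0; have := dist_le v; lra.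
Qed.

Lemma excess_sum1 v :
  \sum_(S : graph n | S \subset star v) excess p q t v S = 1.
Proof.
rewrite -mulr_suml big_split /= -mulr_suml -mulr_sumr -mulr_suml.
rewrite !big_split /= sumrN !bern_sum1 -/(dist1 _ _ _).
by field; rewrite gt_eqF.
Qed.

Lemma planted_ge0 B G : 0 <= planted p q t B G.
Proof.
by apply: prodr_ge0 => v _; case: ifP; rewrite ?excess_ge0 ?bern_ge0.
Qed.

Lemma planted_sum1 B : \sum_(G : graph n) planted p q t B G = 1.
Proof.
rewrite sum_prod_star => [|v G].
  apply: big1 => v _; case: (v \in B); first exact: excess_sum1.
  exact: bern_sum1.
have GS : {in star v, forall e, (e \in G :&: star v) = (e \in G)}.
  by move=> e ev; rewrite inE ev andbT.
by rewrite (excess_eq_in _ _ _ GS) (bern_eq_in _ GS).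
Qed.

Definition planted_dist B : fdist R (graph n) :=
  FDist (planted_ge0 B) (planted_sum1 B).

End PlantedLaw.

(** * The law of the corrupted graph *)

Lemma corrupt_swap B G H :
  corrupt B (corrupt B H G) (corrupt B G H) = H.
Proof. by apply/setP => e; rewrite !inE; case: touches. Qed.

(** Edges touching [B] stay in place, and these include all rows of [B]. The other edges follow the
    same law in both factors and may be exchanged. *)
Lemma gnp_planted_swap p q t B G H :
  gnp p (corrupt B G H) * planted p q t B (corrupt B H G)
  = gnp p G * planted p q t B H.
Proof.
rewrite !gnp_star -!big_split; apply: eq_bigr => v _ /=.
case: ifPn => vB.
  congr (_ * _); [apply: bern_eq_in|apply: excess_eq_in] => e ev;
  by rewrite inE (star_touches vB ev).
rewrite /bern -!big_split; apply: eq_bigr => e _ /=.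
by rewrite !inE; case: touches => //; rewrite mulrC.
Qed.

(* The swap (G, H) |-> (corrupt B G H, corrupt B H G) is an involution of pairs
   of graphs preserving the weight, and it makes the outcome a coordinate. *)
Lemma sum_corrupt_planted p q t B K :
  \sum_(G : graph n) \sum_(H : graph n | corrupt B H G == K)
    gnp p G * planted p q t B H = planted p q t B K.
Proof.
rewrite pair_big_dep /=.
pose swap (GH : graph n * graph n) :=
  (corrupt B GH.1 GH.2, corrupt B GH.2 GH.1).
have swapK : involutive swap by case=> G H; rewrite /swap /= !corrupt_swap.
rewrite (reindex_inj (inv_inj swapK)) /=.
under eq_bigl do rewrite corrupt_swap.
under eq_bigr do rewrite gnp_planted_swap.
rewrite -(pair_big_dep predT (fun _ H => H == K)
  (fun G H => gnp p G * planted p q t B H)) /=.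
under eq_bigr do rewrite big_pred1_eq.
by rewrite -mulr_suml gnp_sum1 mul1r.
Qed.

Lemma corrupted_gnp_planted gamma (A : oblivious_adversary n gamma) p q t K :
    (forall B H, adv_edges A p B H = planted p q t B H) ->
  corrupted_gnp A p K = \sum_B adv_set A p B * planted p q t B K.
Proof.
move=> hA; rewrite /corrupted_gnp exchange_big; apply: eq_bigr => B _ /=.
rewrite -sum_corrupt_planted mulr_sumr; apply: eq_bigr => G _.
by rewrite mulr_sumr; apply: eq_bigr => H _; rewrite hA mulrCA mulrA.
Qed.

(** Expanding the product of binary mixtures selects the corrupted vertices, each independently with
    probability [t / (1 + t)]. *)
Lemma sum_planted p q t K : 0 < t ->
  \sum_(B : {set 'I_n}) bern setT (t / (1 + t)) B * planted p q t B K
  = \prod_v mixed p q t v K.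
Proof.
move=> t0; under [RHS]eq_bigr do rewrite -(mixedE _ _ _ _ t0).
rewrite bigA_distr; apply: eq_big => // B _.
rewrite /bern; under eq_bigl do rewrite inE.
by rewrite -big_split; apply: eq_bigr => v _ /=; case: ifP.
Qed.

Lemma mixed_sum1 p q t :
  0 < t -> \sum_(K : graph n) \prod_v mixed p q t v K = 1.
Proof.
move=> t0; under eq_bigr do rewrite -(sum_planted _ _ _ t0).
rewrite exchange_big /= -[RHS](bern_sum1 [set: 'I_n] (t / (1 + t))).
apply: eq_big => [B|B _]; first by rewrite subsetT.
by rewrite -mulr_sumr planted_sum1 // mulr1.
Qed.

(** * Enforcing the corruption budget *)

Section Budget.
Variables (gamma tau : R).
Hypotheses (gamma0 : 0 <= gamma) (tau01 : 0 <= tau <= 1).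

Definition in_budget B : bool := #|B|%:R <= gamma * n%:R.

(** The fallback is [set0] because it meets every nonnegative budget. *)
Definition trunc_set B : {set 'I_n} := if in_budget B then B else set0.

Definition budget_law B : R :=
  \sum_(C : {set 'I_n} | trunc_set C == B) bern setT tau C.

Lemma sum_budget_law (F : {set 'I_n} -> R) :
  \sum_B budget_law B * F B
  = \sum_(C : {set 'I_n}) bern setT tau C * F (trunc_set C).
Proof.
rewrite [RHS](partition_big trunc_set predT) //=; apply: eq_bigr => B _.
by rewrite mulr_suml; apply: eq_bigr => C /eqP ->.
Qed.

Lemma budget_law_ge0 B : 0 <= budget_law B.
Proof. by apply: sumr_ge0 => C _; rewrite bern_ge0. Qed.

Lemma budget_law_sum1 : \sum_B budget_law B = 1.
Proof.
under eq_bigr do rewrite -[budget_law _]mulr1.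
rewrite (sum_budget_law (fun=> 1)) -[RHS](bern_sum1 [set: 'I_n] tau).
by apply: eq_big => [C|C _]; rewrite ?subsetT ?mulr1.
Qed.

Lemma budget_lawP B : budget_law B != 0 -> in_budget B.
Proof.
apply: contraR => nB; rewrite /budget_law big1 // => C /eqP CB.
move: nB; rewrite -CB /trunc_set; case: ifPn => [-> //|_].
by rewrite /in_budget cards0 mulr_ge0.
Qed.

Definition budget_dist : fdist R {set 'I_n} :=
  FDist budget_law_ge0 budget_law_sum1.

(** Markov's inequality for [#|C|], whose mean is n tau. *)
Lemma over_budget_le :
  gamma * n%:R * \sum_(C : {set 'I_n} | ~~ in_budget C) bern setT tau C
  <= n%:R * tau.
Proof.
have <- : #|'I_n|%:R * tau = n%:R * tau by rewrite card_ord.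
rewrite -bern_mean mulr_sumr big_mkcond /=.
apply: ler_sum => C _; have b0 := bern_ge0 setT C tau01.
case: ifPn => [|_]; last by rewrite mulr_ge0.
by rewrite -ltNge => /ltW le_C; rewrite mulrC ler_wpM2l.
Qed.

End Budget.

End Rows.

(** * The two hiding adversaries *)

Lemma le_fdist1 (R : realType) (T : finType) (F : fdist R T) (x : T) : F x <= 1.
Proof.
rewrite -(fdist_sum1 F) (bigD1 x) //= lerDl.
by apply: sumr_ge0 => y _; exact: fdist_ge0.
Qed.

Lemma fdist_bool (R : realType) (F : fdist R bool) : F false + F true = 1.
Proof. by rewrite -(fdist_sum1 F) big_bool /= addrC. Qed.

(** With nothing corrupted, the two success probabilities sum to at most 1 + 1 / 5, an average of 3
    / 5. *)
Lemma no_corruption_hides (R : realType) (n : nat) (p q gamma : R) :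
    0 <= gamma -> dist1 [set: edge n] p q <= 1 / 5 ->
  exists A : oblivious_adversary n gamma,
  forall alg : algorithm R n, ~ distinguishes A alg p q (65 / 100).
Proof.
move=> g0 pq.
have d0 (T : finType) (x y : T) : 0 <= (y == x)%:R :> R by [].
have d1 (T : finType) (x : T) : \sum_y (y == x)%:R = 1 :> R.
  by rewrite (bigD1 x) //= eqxx big1 ?addr0 // => y /negPf ->.
pose dirac (T : finType) (x : T) : fdist R T := FDist (d0 T x) (d1 T x).
have bud (r : R) (B : {set 'I_n}) :
    dirac _ set0 B != 0 -> #|B|%:R <= gamma * n%:R.
  by rewrite pnatr_eq0 eqb0 negbK => /eqP ->; rewrite cards0 mulr_ge0.
pose A : oblivious_adversary n gamma :=
  @Adversary R n gamma (fun=> dirac _ set0) (fun _ _ => dirac _ set0) bud.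
exists A => alg.
have cE r K : corrupted_gnp A r K = gnp r K.
  rewrite /corrupted_gnp (bigD1 K) //= [X in _ + X]big1 ?addr0 => [|G GK].
    rewrite (bigD1 set0) //= [X in _ + X]big1 ?addr0 => [|B /negPf ->]; last first.
      by rewrite big1 // => H _; rewrite mulr0 mul0r.
    rewrite eqxx mulr1 -mulr_sumr (bigD1 set0) //=; last first.
      by apply/eqP/setP => e; rewrite inE; case: ifP => // /existsP[v]; rewrite inE.
    by rewrite eqxx big1 ?addr0 ?mulr1 // => H /andP[_ /negPf ->].
  apply: big1 => B _; apply: big1 => H hK /=.
  have [B0|_] := eqVneq B set0; last by rewrite mulr0 mul0r.
  case/eqP: GK; rewrite -(eqP hK); apply/setP => e; rewrite inE.
  by case: ifP => // /existsP[v]; rewrite B0 inE.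
apply/negP; rewrite -ltNge /correct_prob /output_prob.
suff : \sum_K corrupted_gnp A p K * alg K false +
       \sum_K corrupted_gnp A q K * alg K true <= 1 + 1 / 5 by lra.
apply: (@le_trans _ _ (1 + dist1 [set: edge n] p q)); last by rewrite lerD2l.
rewrite -big_split /= -[X in _ <= X + _](gnp_sum1 n p).
rewrite /dist1 [X in _ <= _ + X](eq_bigl predT) => [|S]; last by rewrite subsetT.
rewrite -big_split /=; apply: ler_sum => K _.
rewrite !cE -!gnp_bernT.
have a1 := le_fdist1 (alg K) true; have a0 := fdist_ge0 (alg K) true.
have := fdist_bool (alg K) => fE.
have -> : alg K false = 1 - alg K true by lra.
have : (gnp q K - gnp p K) * alg K true <= `|gnp p K - gnp q K|.
  rewrite distrC; apply: le_trans (ler_norm _) _.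
  by rewrite normrM ler_piMr // ger0_norm.
lra.
Qed.

(** On the common untruncated mixture the two success probabilities sum to 1; truncation adds at
    most 1 / 10 to each, for an average of at most 3 / 5. *)
Lemma planting_hides (R : realType) (n : nat) (p q gamma : R) :
    (0 < n)%N -> 0 <= p <= 1 -> 0 <= q <= 1 -> 0 < gamma ->
    (forall v : 'I_n, dist1 (star v) p q <= gamma / 5) ->
  exists A : oblivious_adversary n gamma,
  forall alg : algorithm R n, ~ distinguishes A alg p q (65 / 100).
Proof.
move=> n0 p01 q01 g0 pq.
pose t := gamma / 10; have t0 : 0 < t by rewrite /t; lra.
pose tau := t / (1 + t).
have tau_ge0 : 0 <= tau by rewrite divr_ge0 //; lra.
have tau_le : tau <= t.
  rewrite /tau ler_pdivrMr; last by lra.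
  by rewrite mulrDr mulr1 lerDl mulr_ge0 // ltW.
have tau01 : 0 <= tau <= 1.
  by rewrite tau_ge0 /tau ler_pdivrMr; lra.
have dpq (v : 'I_n) : dist1 (star v) p q <= 2 * t by have := pq v; rewrite /t; lra.
have dqp (v : 'I_n) : dist1 (star v) q p <= 2 * t by rewrite dist1C.
pose A : oblivious_adversary n gamma := @Adversary R n gamma
  (fun=> budget_dist n gamma tau01)
  (fun r B => if r == p then planted_dist p01 q01 t0 dpq B
                           else planted_dist q01 p01 t0 dqp B)
  (fun=> @budget_lawP R n gamma tau (ltW g0)).
pose over := \sum_(C : {set 'I_n} | ~~ in_budget gamma C) bern setT tau C.
(* Markov gives over <= tau / gamma <= t / gamma = 1 / 10. *)
have over_le : over <= 1 / 10.
  have := over_budget_le n gamma tau01; rewrite -/over mulrAC (mulrC n%:R).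
  rewrite ler_pM2r ?ltr0n // => h.
  have : gamma * over <= gamma * (1 / 10) by rewrite /t in tau_le; lra.
  by rewrite ler_pM2l.
(* Truncation changes the expectation of a test with values in [0, 1] only on over-budget sets. *)
have out r r' (a : graph n -> R) : (forall K, 0 <= a K <= 1) ->
    0 <= r <= 1 -> 0 <= r' <= 1 -> (forall v : 'I_n, dist1 (star v) r r' <= 2 * t) ->
    (forall B H, adv_edges A r B H = planted r r' t B H) ->
    \sum_K corrupted_gnp A r K * a K
    <= \sum_K (\prod_v mixed r r' t v K) * a K + over.
  move=> a01 r01 r01' drr hA.
  have F01 B : 0 <= \sum_K planted r r' t B K * a K <= 1.
    rewrite sumr_ge0 => [|K _]; last first.
      by rewrite mulr_ge0 ?planted_ge0 //; case/andP: (a01 K).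
    rewrite -(planted_sum1 r r' t0 B); apply: ler_sum => K _.
    by rewrite ler_piMr ?planted_ge0 //; case/andP: (a01 K).
  pose F B := \sum_K planted r r' t B K * a K.
  have -> : \sum_K corrupted_gnp A r K * a K = \sum_B budget_law gamma tau B * F B.
    under eq_bigr do rewrite (corrupted_gnp_planted _ hA) mulr_suml.
    rewrite exchange_big; apply: eq_bigr => B _ /=.
    by rewrite mulr_sumr; apply: eq_bigr => K _; rewrite mulrA.
  have -> : \sum_K (\prod_v mixed r r' t v K) * a K =
      \sum_(C : {set 'I_n}) bern setT tau C * F C.
    under eq_bigr do rewrite -(sum_planted _ _ _ t0) mulr_suml.
    rewrite exchange_big; apply: eq_bigr => B _ /=.
    by rewrite mulr_sumr; apply: eq_bigr => K _; rewrite mulrA.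
  rewrite sum_budget_law /over [X in _ <= _ + X]big_mkcond -big_split /=; apply: ler_sum => C _.
  have b0 := bern_ge0 setT C tau01.
  rewrite /trunc_set; case: ifPn => _; first by rewrite addr0.
  rewrite -[leLHS]add0r lerD //; first by rewrite mulr_ge0 //; case/andP: (F01 C).
  by rewrite ler_piMr //; case/andP: (F01 set0).
exists A => alg; apply/negP; rewrite -ltNge /correct_prob /output_prob.
have a01 b K : 0 <= alg K b <= 1 by rewrite fdist_ge0 le_fdist1.
have h0 := out p q (alg^~ false) (a01 false) p01 q01 dpq.
have h1 := out q p (alg^~ true) (a01 true) q01 p01 dqp.
have e0 B H : adv_edges A p B H = planted p q t B H by rewrite /= eqxx.
have e1 B H : adv_edges A q B H = planted q p t B H.
  (* If [q = p] the first branch is taken, and it is the same law. *)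
  by rewrite /=; case: eqP => //= ->.
have := lerD (h0 e0) (h1 e1).
have mE : \sum_K (\prod_v mixed p q t v K) * alg K false +
   \sum_K (\prod_v mixed q p t v K) * alg K true = 1.
  rewrite -[RHS](mixed_sum1 n p q t0) -big_split; apply: eq_bigr => K _ /=.
  under [X in _ + X * _]eq_bigr do rewrite mixedC.
  by rewrite -mulrDr fdist_bool mulr1.
by move: mE; lra.
Qed.

(** * Choice of adversary according to the largest shift *)

Theorem theorem5p1 (R : realType) (n : nat) (p gamma : R)
    (hn : (0 < n)%N) (hp : 0 <= p <= 1 / 2) (hgamma : 0 <= gamma <= 1) :
  exists A : oblivious_adversary n gamma,
  forall alg : algorithm R n,
    ~ distinguishes A alg p
        (p + 1 / 10 * Num.max (gamma * Num.sqrt (p / n%:R))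
                        (Num.max (gamma / n%:R) (Num.sqrt p / n%:R)))
        (65 / 100).
Proof.
have /andP[p0 p2] := hp; have /andP[g0 g1] := hgamma.
have N0 : 0 < n%:R :> R by rewrite ltr0n.
have N1 : 1 <= n%:R :> R by rewrite ler1n.
have p01 : 0 <= p <= 1 by rewrite p0; lra.
set a := gamma * _; set b := gamma / _; set c := Num.sqrt p / _.
have sp0 := sqrtr_ge0 p; have sp2 : Num.sqrt p ^+ 2 = p by rewrite sqr_sqrtr.
have pnle : Num.sqrt (p / n%:R) <= 1.
  rewrite -[leRHS]sqrtr1 ler_wsqrtr // ler_pdivrMr //; lra.
have a0 : 0 <= a by rewrite mulr_ge0 // sqrtr_ge0.
have a1 : a <= 1 by rewrite mulr_ile1 // sqrtr_ge0.
have b0 : 0 <= b by rewrite divr_ge0 // ltW.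
have b1 : b <= 1 by rewrite /b ler_pdivrMr //; lra.
have c0 : 0 <= c by rewrite divr_ge0 // ltW.
set m := Num.max a _.
(* A zero shift makes the models equal. Otherwise the term attaining the maximum is nonzero, which
   yields the positivity of [gamma] or [p] used below. *)
have [m0|m0] := eqVneq m 0.
  apply: no_corruption_hides => //; rewrite m0 mulr0 addr0 /dist1 big1 //.
    by lra.
  by move=> S _; rewrite subrr normr0.
have : m = a \/ m = b \/ m = c.
  by rewrite /m; case: (leP a); case: (leP b); auto.
case=> [ma|[mb|mc]].
- have gp : 0 < gamma.
    by rewrite lt_def g0 andbT; apply: contraNneq m0 => g; rewrite ma /a g mul0r.
  have pp : 0 < p.
    rewrite lt_def p0 andbT; apply: contraNneq m0 => E.
    by rewrite ma /a E mul0r sqrtr0 mulr0.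
  apply: planting_hides => //; first by apply/andP; split; rewrite ma; lra.
  (* Here [s = gamma]: at most n edges, each contributing gamma^2 / (50 n). *)
  move=> v; apply: (@le_trans _ _ (3 / 20 * gamma)); last by lra.
  apply: dist1_le_chi_square; rewrite ?pp ?gp //.
  have -> : 2 * (1 / 10 * m) ^+ 2 / p = 1 / 50 * gamma ^+ 2 / n%:R.
    rewrite ma /a !exprMn sqr_sqrtr; last by rewrite divr_ge0 // ltW.
    by field; rewrite !gt_eqF.
  rewrite mulrCA ger_pMr; last by rewrite mulr_gt0 ?exprn_gt0 //; lra.
  by rewrite ler_pdivrMr // mul1r ler_nat card_star.
- have gp : 0 < gamma.
    by rewrite lt_def g0 andbT; apply: contraNneq m0 => g; rewrite mb /b g mul0r.
  apply: planting_hides => //; first by apply/andP; split; rewrite mb; lra.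
  (* With at most n edges, the linear bound is at most 2 n (b / 10) = gamma / 5. *)
  move=> v; apply: le_trans (dist1_le_linear _ _ _ _) _; rewrite ?mb //; try lra.
  have : #|star v|%:R * b <= n%:R * b by rewrite ler_wpM2r // ler_nat card_star.
  have -> : n%:R * b = gamma by rewrite mulrC divfK // gt_eqF.
  lra.
- have pp : 0 < p.
    rewrite lt_def p0 andbT; apply: contraNneq m0 => E.
    by rewrite mc /c E sqrtr0 mul0r.
  apply: no_corruption_hides => //.
  (* Here [s = 1]: at most n^2 edges in the whole graph, each contributing 1 / (50 n^2). *)
  apply: (@le_trans _ _ (3 / 20 * 1)); last by lra.
  apply: dist1_le_chi_square; rewrite ?pp ?ltr01 ?lexx //.
  have -> : 2 * (1 / 10 * m) ^+ 2 / p = 1 / 50 * (n%:R * n%:R)^-1.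
    rewrite mc /c !exprMn sp2.
    by field; rewrite !gt_eqF.
  rewrite expr1n mulrCA ler_wpM2l //; first by lra.
  by rewrite ler_pdivrMr ?mulr_gt0 // mul1r -natrM ler_nat card_edge.
Qed.
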